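(* Let $G$ be a finite simple graph and let $k \geq 4$ be an integer. If $\chi(G^2) \leq k$, then $\mathrm{sa}(G) \leq \lceil k/2 \rceil + 1$.
   Context: The square $G^2$ of a graph $G$ is the graph with the same vertex set as $G$ in which two distinct vertices are adjacent if and only if their distance in $G$ is at most $2$; $\chi(G^2)$ is its chromatic number. A star is a complete bipartite graph $K_{1,m}$ with $m\ge 1$. A galaxy (star forest) is a union of vertex-disjoint stars. The star arboricity $\mathrm{sa}(G)$ of a finite simple graph $G$ is the minimum number of galaxies (subgraphs of $G$) whose edge sets partition the edge set of $G$. *)

(* Defs.v *)
From mathcomp Require Import all_boot.

Set Implicit Arguments.
Unset Strict Implicit.
Unset Printing Implicit Defensive.

Record sgraph := SGraph {
  vertex :> finType;
  adj : rel vertex;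
  adj_sym : symmetric adj;
  adj_irr : irreflexive adj
}.

Definition edges (G : sgraph) : {set {set G}} :=
  [set [set u.1; u.2] | u : G * G & adj u.1 u.2].

Definition has_path (G : sgraph) (x y : G) (n : nat) : bool :=
  [exists p : n.-tuple G,
     [&& path (@adj G) x p, uniq (x :: p) & last x p == y]].

(* The length of a shortest path from [x] to [y]; [None] stands for an infinite
   distance. A path has fewer than [#|G|] edges, so the bound loses nothing. *)
Definition dist (G : sgraph) (x y : G) : option nat :=
  ohead [seq n <- iota 0 #|G| | has_path x y n].

Lemma dist_SomeP (G : sgraph) (x y : G) (d : nat) :
  dist x y = Some d <->
  has_path x y d /\ forall n, has_path x y n -> d <= n.
Proof.
have lt_path n : has_path x y n -> n < #|G|.
  case/existsP=> p /and3P[_ Up _].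
  have := max_card [in x :: p]; rewrite (card_uniqP Up) /= size_tuple.
  by [].
have mem_path n : (n \in [seq n <- iota 0 #|G| | has_path x y n]) = has_path x y n.
  rewrite mem_filter mem_iota add0n leq0n /=.
  by apply: andb_idr; apply: lt_path.
have srt : sorted ltn [seq n <- iota 0 #|G| | has_path x y n].
  by rewrite sorted_filter ?iota_ltn_sorted //; apply: ltn_trans.
rewrite /dist; move: mem_path srt.
case: [seq _ <- _ | _] => [|m s] mem_path /= srt.
  by split=> // -[]; rewrite -mem_path.
have min_m n : has_path x y n -> m <= n.
  rewrite -mem_path inE => /orP[/eqP-> //|ns].
  by have /allP/(_ n ns)/ltnW := order_path_min ltn_trans srt.
have path_m : has_path x y m by rewrite -mem_path mem_head.
split=> [[<-] // | [pd min_d]].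
by congr Some; apply/eqP; rewrite eqn_leq min_m // min_d.
Qed.

Lemma has_path_sym (G : sgraph) (x y : G) n : has_path x y n = has_path y x n.
Proof.
suff imp (a b : G) : has_path a b n -> has_path b a n by apply/idP/idP; apply: imp.
case/existsP=> p /and3P[Pp Up /eqP<-]; apply/existsP.
have sz : size (rev (belast a p)) == n by rewrite size_rev size_belast size_tuple.
exists (Tuple sz); apply/and3P; split.
- by rewrite /= rev_path (eq_path (e' := @adj G)) // => u v; rewrite adj_sym.
- by rewrite -[_ :: _]/(last a p :: rev (belast a p)) -rev_rcons -lastI rev_uniq.
- by rewrite /=; case: (tval p) => [|c q] //=; rewrite rev_cons last_rcons.
Qed.

Lemma dist_sym (G : sgraph) (x y : G) : dist x y = dist y x.
Proof.
by congr ohead; apply: eq_filter => n; apply: has_path_sym.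
Qed.

Definition square_adj (G : sgraph) : rel G :=
  fun x y => (x != y) && (if dist x y is Some d then d <= 2 else false).

Lemma square_adj_sym (G : sgraph) : symmetric (@square_adj G).
Proof. by move=> x y; rewrite /square_adj eq_sym dist_sym. Qed.

Lemma square_adj_irr (G : sgraph) : irreflexive (@square_adj G).
Proof. by move=> x; rewrite /square_adj eqxx. Qed.

Definition square (G : sgraph) : sgraph :=
  SGraph (@square_adj_sym G) (@square_adj_irr G).

Definition colorable (G : sgraph) (k : nat) : bool :=
  [exists f : {ffun G -> 'I_k}, forall x, forall y, adj x y ==> (f x != f y)].

Lemma ex_colorable (G : sgraph) : exists k, colorable G k.
Proof.
exists #|G|; apply/existsP; exists [ffun x => enum_rank x].
apply/forallP=> x; apply/forallP=> y; apply/implyP=> xy.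
rewrite !ffunE (inj_eq enum_rank_inj); apply: contraTneq xy => ->.
by rewrite adj_irr.
Qed.

Definition chromatic_number (G : sgraph) : nat := ex_minn (ex_colorable G).

(* Stars and galaxies have no isolated vertices (as m >= 1 in K_{1,m}), so each
   is represented by its edge set [S], its vertex set being [cover S]. *)
Definition is_star (T : finType) (S : {set {set T}}) : bool :=
  [exists c : T, exists L : {set T},
     [&& c \notin L, L != set0 & S == [set [set c; l] | l in L]]].

Definition is_galaxy (T : finType) (F : {set {set T}}) : bool :=
  [exists P : {set {set {set T}}},
     [&& [forall S in P, is_star S],
         [forall S1 in P, forall S2 in P,
            (S1 != S2) ==> [disjoint cover S1 & cover S2]]
       & F == cover P]].

(* [partition] excludes empty blocks; this does not affect the minimum below. *)
Definition galaxy_partition (G : sgraph) (D : {set {set {set G}}}) : bool :=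
  partition D (edges G) && [forall F in D, is_galaxy F].

Lemma ex_galaxy_partition (G : sgraph) :
  exists n, [exists D : {set {set {set G}}}, galaxy_partition D && (#|D| == n)].
Proof.
pose D := [set [set e] | e in edges G].
exists #|D|; apply/existsP; exists D; rewrite eqxx andbT; apply/andP; split.
  apply/and3P; split.
  - rewrite cover_imset; apply/eqP/setP=> e; apply/bigcupP/idP.
      by case=> f fE; rewrite inE => /eqP->.
    by move=> eE; exists e; rewrite ?inE.
  - apply/trivIsetP=> A B /imsetP[e _ ->] /imsetP[f _ ->] ef.
    by rewrite disjoints1 inE; apply: contraNneq ef => ->.
  - by apply/imsetP=> -[e _ /setP/(_ e)]; rewrite !inE eqxx.
apply/forall_inP=> F /imsetP[e /imsetP[[x y]]]; rewrite inE /= => xy -> ->.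
apply/existsP; exists [set [set [set x; y]]]; apply/and3P; split.
- apply/forall_inP=> S; rewrite inE => /eqP->.
  apply/existsP; exists x; apply/existsP; exists [set y].
  rewrite imset_set1 eqxx andbT; apply/andP; split.
    by rewrite inE; apply: contraTneq xy => ->; rewrite adj_irr.
  by apply/set0Pn; exists y; rewrite inE.
- apply/forall_inP=> S; rewrite inE => /eqP->.
  by apply/forall_inP=> S'; rewrite inE => /eqP->; rewrite eqxx.
- by rewrite /cover big_set1.
Qed.

Definition star_arboricity (G : sgraph) : nat := ex_minn (ex_galaxy_partition G).

(* Main.v *)
Require Import Defs.
From mathcomp Require Import all_boot.
From mathcomp Require Import zify.

(** The argument pulls a star decomposition of a complete graph back to [G].

    A proper colouring [f] of the square of [G] gives distinct colours to
    adjacent vertices and to any two neighbours of a common vertex, so it is a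
    locally injective homomorphism from [G] to the complete graph on the
    colours ([square_coloring]).  Under such a map the edges of [G] lying over
    a star of the complete graph, with centre [i] and leaves [L], again form a
    galaxy: a vertex coloured in [L] has at most one neighbour of colour [i].
    Hence it is enough to split the edges of a complete graph on [2 * m]
    colours, where [m = uphalf k] so that [k <= 2 * m], into [m + 1] galaxies.

    To do so, write the colours as [a_i = 2 * i] and [b_i = 2 * i + 1] for
    [i < m].  The [m] edges [a_i b_i] form one galaxy.  For [i < j], the four
    remaining edges between the pairs [i] and [j] form a 4-cycle, which is
    oriented cyclically as [a_i -> a_j -> b_i -> b_j -> a_i].  Every vertex of
    the pair [i] then points to exactly one vertex of the pair [j] and
    conversely, so the edges pointing into the pair [j] form two disjoint stars,
    with centres [a_j] and [b_j].  That gives [m] further galaxies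
    ([galaxy_index_center], [galaxy_index_inj]). *)

(** * Galaxies from a choice of centres *)

(** The stars are indexed by the centres that have at least one leaf; they are
    disjoint because a leaf determines its centre. *)
Lemma is_galaxy_centers {T : finType} (C : {set T}) (r : rel T) :
    (forall x x' y, x \in C -> x' \in C -> y \notin C ->
       r x y -> r x' y -> x = x') ->
  is_galaxy [set [set u.1; u.2] | u : T * T &
               [&& u.1 \in C, u.2 \notin C & r u.1 u.2]].
Proof.
move=> r_inj.
pose leaves x := [set y | (y \notin C) && r x y].
pose star x := [set [set x; y] | y in leaves x].
have cover_star x z : z \in cover (star x) ->
    z = x \/ z \in leaves x.
  rewrite cover_imset => /bigcupP[y yx]; rewrite !inE.
  by case/orP=> /eqP->; [left | right; rewrite inE in yx].
apply/existsP; exists [set star x | x in C & leaves x != set0].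
apply/and3P; split.
- apply/forall_inP=> S /imsetP[x]; rewrite inE => /andP[xC Lx] ->.
  apply/existsP; exists x; apply/existsP; exists (leaves x).
  by rewrite Lx eqxx inE xC.
- apply/forall_inP=> S1 /imsetP[x1]; rewrite inE => /andP[x1C _] ->.
  apply/forall_inP=> S2 /imsetP[x2]; rewrite inE => /andP[x2C _] ->.
  apply/implyP=> neS; rewrite disjoint_subset; apply/subsetP=> z z1.
  rewrite inE; apply: contraNN neS => z2.
  have [z1x|] := cover_star _ _ z1; have [z2x|] := cover_star _ _ z2.
  + by rewrite -z1x -z2x.
  + by rewrite inE z1x x1C.
  + by rewrite inE z2x x2C.
  + rewrite !inE => /andP[zC rx2] /andP[_ rx1].
    by rewrite (r_inj _ _ _ x1C x2C zC rx1 rx2).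
- apply/eqP/setP=> e; apply/imsetP/bigcupP.
    case=> -[x y]; rewrite inE /= => /and3P[xC yC rxy] ->.
    have yx : y \in leaves x by rewrite inE yC.
    exists (star x); last by apply: imset_f.
    by apply: imset_f; rewrite inE xC; apply/set0Pn; exists y.
  case=> S /imsetP[x]; rewrite inE => /andP[xC _] -> /imsetP[y].
  by rewrite inE => /andP[yC rxy] ->; exists (x, y); rewrite // inE /= xC yC.
Qed.

(** * Star arboricity from a colouring of the edges *)

Definition edge_class {G : sgraph} {n} (col : G -> G -> 'I_n) (c : 'I_n) :
    {set {set G}} :=
  [set [set u.1; u.2] | u : G * G & adj u.1 u.2 && (col u.1 u.2 == c)].

(** Colours that occur on no edge are dropped, since [partition] excludes
    empty blocks. *)
Lemma star_arboricity_le {G : sgraph} {n} (col : G -> G -> 'I_n) :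
    (forall x y, col x y = col y x) ->
    (forall c, is_galaxy (edge_class col c)) ->
  star_arboricity G <= n.
Proof.
move=> colC gal; pose D := [set edge_class col c | c : 'I_n] :\ set0.
have leDn : #|D| <= n.
  apply: leq_trans (subset_leq_card (subD1set _ _)) _.
  by rewrite -[leqRHS]card_ord leq_imset_card.
apply: leq_trans leDn; rewrite /star_arboricity; case: ex_minnP => a _; apply.
apply/existsP; exists D; rewrite eqxx andbT; apply/andP; split; last first.
  by apply/forall_inP=> F /setD1P[_ /imsetP[c _ ->]].
apply/and3P; split; last by rewrite !inE eqxx.
- apply/eqP/setP=> e; apply/bigcupP/imsetP.
    case=> F /setD1P[_ /imsetP[c _ ->]] /imsetP[u].
    by rewrite inE => /andP[au _] ->; exists u; rewrite ?inE.
  case=> u; rewrite inE => au ->; exists (edge_class col (col u.1 u.2)).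
    rewrite !inE imset_f // andbT; apply/set0Pn; exists [set u.1; u.2].
    by apply: imset_f; rewrite inE au eqxx.
  by apply: imset_f; rewrite inE au eqxx.
- apply/trivIsetP=> F1 F2 /setD1P[_ /imsetP[c1 _ ->]] /setD1P[_ /imsetP[c2 _ ->]].
  apply: contraNT => /pred0Pn[e /andP[/imsetP[[x y]]]].
  rewrite !inE /= => /andP[axy /eqP<-] -> /imsetP[[x' y']].
  rewrite inE /= => /andP[_ /eqP<-] eE.
  have := set21 x y; have := set22 x y; rewrite eE !inE.
  have ne_xy : x != y by apply: contraTneq axy => ->; rewrite adj_irr.
  by case/orP=> /eqP yE; case/orP=> /eqP xE; move: ne_xy;
    rewrite xE yE ?eqxx // colC.
Qed.

(** * A decomposition of the complete graph on [2 * m] colours *)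

(** The galaxy containing the edge [i j]: the index [m] is that of the
    matching, and otherwise the index is the pair of the head of the edge in
    the cyclic orientation. *)
Definition galaxy_index (m i j : nat) : nat :=
  if i./2 == j./2 then m
  else if odd i == odd j then maxn i./2 j./2 else minn i./2 j./2.

(** In the matching either end of an edge may serve as the centre; the even one
    is chosen. *)
Definition is_center (m c i : nat) : bool :=
  if c == m then ~~ odd i else i./2 == c.

Lemma galaxy_indexC m i j : galaxy_index m i j = galaxy_index m j i.
Proof.
by rewrite /galaxy_index eq_sym maxnC minnC [odd i == _]eq_sym.
Qed.

Lemma galaxy_index_le m i j :
  i < m.*2 -> j < m.*2 -> galaxy_index m i j <= m.
Proof. by rewrite /galaxy_index => im jm; do 2?case: ifP => _; lia. Qed.

Lemma galaxy_index_center m i j : i < m.*2 -> j < m.*2 -> i != j ->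
  is_center m (galaxy_index m i j) j = ~~ is_center m (galaxy_index m i j) i.
Proof.
rewrite /is_center /galaxy_index => im jm ij.
by case: (i./2 =P j./2) => ?; [|case: (odd i =P odd j) => ?]; case: ifP; lia.
Qed.

(** In the matching, [j] has only one partner.  Otherwise [j] points to exactly
    one vertex of the pair [c], whose parity is determined by that of [j] and by
    the order of [j./2] and [c]. *)
Lemma galaxy_index_inj m c i i' j : j < m.*2 -> i < m.*2 -> i' < m.*2 ->
    is_center m c i -> is_center m c i' -> ~~ is_center m c j ->
    galaxy_index m i j = c -> galaxy_index m i' j = c -> i = i'.
Proof.
rewrite /is_center /galaxy_index => jm im im'.
by case: (c =P m) => ?; case: (i./2 =P j./2) => ?; case: (i'./2 =P j./2) => ?;
  case: (odd i =P odd j) => ?; case: (odd i' =P odd j) => ?; lia.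
Qed.

(** * Colourings of the square *)

Lemma square_adj_path {G : sgraph} (x y : G) n :
  x != y -> n <= 2 -> has_path x y n -> adj (x : square G) y.
Proof.
move=> xy n2 pn; rewrite /= /square_adj xy /=.
have ex_p : exists n, has_path x y n by exists n.
case: (ex_minnP ex_p) => d pd min_d.
have -> : dist x y = Some d by apply/dist_SomeP.
exact: leq_trans (min_d n pn) n2.
Qed.

Lemma square_coloring {G : sgraph} {k} : chromatic_number (square G) <= k ->
  exists f : G -> 'I_k,
    (forall x y, adj x y -> f x != f y) /\
    (forall x y z, adj x z -> adj y z -> f x = f y -> x = y).
Proof.
rewrite /chromatic_number; case: ex_minnP => h /existsP[g /forallP gP] _ hk.
have sqP (x y : square G) : adj x y -> widen_ord hk (g x) != widen_ord hk (g y).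
  by move=> xy; have /forallP/(_ y)/implyP/(_ xy) := gP x.
exists (fun x => widen_ord hk (g x)); split=> [x y xy|x y z xz yz /eqP fxy].
  have ne_xy : x != y by apply: contraTneq xy => ->; rewrite adj_irr.
  apply/sqP/(@square_adj_path _ _ _ 1) => //.
  by apply/existsP; exists [tuple y]; rewrite /= xy !inE ne_xy eqxx.
apply: contraTeq fxy => ne_xy; apply/sqP/(@square_adj_path _ _ _ 2) => //.
apply/existsP; exists [tuple z; y]; rewrite /= xz adj_sym yz !inE eqxx !andbT.
rewrite negb_or ne_xy andbT /=.
by apply/andP; split; [apply: contraTneq xz | apply: contraTneq yz] => ->;
  rewrite adj_irr.
Qed.

(** * The bound *)

Theorem theorem4 (G : sgraph) (k : nat) :
  4 <= k -> chromatic_number (square G) <= k ->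
  star_arboricity G <= uphalf k + 1.
Proof.
move=> _ /square_coloring[f [f_proper f_inj]]; rewrite addn1.
set m := uphalf k.
have fm x : f x < m.*2 by have := ltn_ord (f x); rewrite /m; lia.
pose col x y : 'I_m.+1 := inord (galaxy_index m (f x) (f y)).
have colE x y : col x y = galaxy_index m (f x) (f y) :> nat.
  by rewrite inordK // ltnS galaxy_index_le.
apply: (star_arboricity_le col) => [x y|c]; first by rewrite /col galaxy_indexC.
pose C := [set x | is_center m c (f x)].
have r_inj x x' y : x \in C -> x' \in C -> y \notin C ->
    adj x y && (col x y == c) -> adj x' y && (col x' y == c) -> x = x'.
  rewrite !inE => xC x'C yC /andP[xy /eqP cx] /andP[x'y /eqP cx'].
  apply: f_inj xy x'y _; apply: val_inj.
  by apply: (galaxy_index_inj m c _ _ _ (fm y) (fm x) (fm x') xC x'C yC);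
    rewrite -colE (cx, cx').
have := is_galaxy_centers C _ r_inj; congr is_galaxy.
apply/setP=> e; apply/imsetP/imsetP => -[[x y]]; rewrite inE /=.
  by case/and3P=> _ _ xyc ->; exists (x, y); rewrite ?inE.
case/andP=> xy /eqP cxy ->.
(* One end of the edge is a centre and the other is not; swap them if needed. *)
have := galaxy_index_center m _ _ (fm x) (fm y) (f_proper x y xy).
rewrite -colE cxy; case xC: (is_center m c (f x)) => /= yC.
  by exists (x, y); rewrite // !inE /= xC yC xy cxy eqxx.
exists (y, x); last by rewrite setUC.
rewrite !inE /= xC yC adj_sym xy /=.
by apply/eqP; rewrite -cxy /col galaxy_indexC.
Qed.
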